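(* Let $q=p^r \equiv 5 \pmod{8}$ for a prime $p$. Write $q=x^2+y^2$ for integers $x$ and $y$, such that $x \equiv 1 \pmod{4}$, and $p \nmid x$. Then $$\mathcal{K}_3(G_4(q)) = \frac{q(q-1)(q+2x-7)}{2^{6}}.$$
   Context: $G_4(q)$ is the digraph with vertex set the finite field $\mathbb{F}_q$ where $a \to b$ is an edge if and only if $b-a$ is a nonzero fourth power in $\mathbb{F}_q$ (since $q\equiv 5 \pmod 8$, $-1$ is not a fourth power). For a digraph $G$, $\mathcal{K}_m(G)$ is the number of transitive subtournaments of order $m$ contained in $G$; a tournament of order $m$ is transitive if its vertices can be listed $a_1,\dots,a_m$ with $a_i \to a_j$ for all $i<j$. *)

(* Defs.v *)
From HB Require Import structures.
From mathcomp Require Import all_boot all_order all_algebra.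

Set Implicit Arguments.
Unset Strict Implicit.
Unset Printing Implicit Defensive.

Import Order.TTheory GRing.Theory Num.Theory.
Local Open Scope ring_scope.

(* A digraph on [V] is a [rel V]; a subdigraph is a pair (vertex set, arc set). *)
Section Digraphs.

Variable V : finType.
Implicit Types (G : rel V) (S : {set V}) (A : {set V * V}).

Definition is_subdigraph G S A : bool :=
  [forall e in A, [&& e.1 \in S, e.2 \in S & G e.1 e.2]].

Definition is_tournament S A : bool :=
  [&& A \subset setX S S,
      [forall a, (a, a) \notin A] &
      [forall a in S, forall b in S,
         (a != b) ==> (((a, b) \in A) (+) ((b, a) \in A))]].

(* A tuple of length #|S| whose set of entries is S has no repetition. *)
Definition is_transitive S A : bool :=
  [exists s : #|S|.-tuple V,
     ([set a in s] == S) &&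
     [forall i : 'I_#|S|, forall j : 'I_#|S|,
        (i < j)%N ==> ((tnth s i, tnth s j) \in A)]].

Definition transitive_subtournaments (m : nat) G : {set {set V} * {set V * V}} :=
  [set T : {set V} * {set V * V} | [&& #|T.1| == m, is_subdigraph G T.1 T.2,
               is_tournament T.1 T.2 & is_transitive T.1 T.2]].

Definition num_transitive_subtournaments (m : nat) G : nat :=
  #|transitive_subtournaments m G|.

End Digraphs.

Definition G4 (F : finFieldType) : rel F :=
  fun a b => [exists c : F, (c != 0) && (b - a == c ^+ 4)].

(* Main.v *)
Require Import Defs.
From HB Require Import structures.
From mathcomp Require Import all_boot all_order all_algebra cyclic finfield.
From mathcomp Require Import zify ring.

Set Implicit Arguments.
Unset Strict Implicit.
Unset Printing Implicit Defensive.

Import Order.TTheory GRing.Theory Num.Theory.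
Local Open Scope ring_scope.

(** A transitive tournament on three vertices is listed in only one way as
[a -> b -> c] with [a -> c], so the left-hand side counts the triples
[(a, b, c)] with all three of [b - a], [c - b], [c - a] in the group [H] of
nonzero fourth powers.  Writing [b - a = (c - a) u], this is [q * m * N] with
[m = |H| = (q - 1) / 4] and [N] the number of [u] in [H] such that [1 - u] is
in [H]; it remains to show [16 N = q + 2 x - 7].

Let [psi] be the quadratic character of [F] and
[J(a) = \sum_t psi(t) psi(t^2 + a)] the Jacobsthal sums.  Since [m] is odd,
[-1] is a square but not a fourth power; the involution [u |-> 1/u] of [H]
therefore exchanges the [u] with [1 - u] in [H] and those with [1 - u] in [-H],
and evaluating [\sum_c psi(1 - c^4)] in two ways gives [J(-1) = 16 N - q + 7]
([jsumN1_quartic]).  So [J(-1) = 2 x0], where [x0] is an integer congruent to 1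
modulo 4.

Three facts identify [x0] with [x].  The second moment of [J], together with
[J(c^2 a) = psi(c) J(a)], gives [J(-1)^2 + J(g)^2 = 4 q] for a nonsquare [g]
([jsum_sum_two_squares]), so [q = x0^2 + y0^2].  In [F], Euler's formula
[psi(v) = v^((q-1)/2)] and the vanishing of power sums give
[J(-1) = 'C(2 m, m)] ([jsumN1_bin]), and Legendre's formula shows that [p] does
not divide this binomial ([prime_ndvd_central_bin]); hence [p] does not divide
[x0].  Finally a power of an odd prime [p] is in at most one way the sum of an
odd square prime to [p] and another square ([sum_two_squares_uniq]), so
[x0 = x] or [x0 = - x], and the congruence modulo 4 fixes the sign. *)

(** * Transitive subtournaments of order three *)

(** The triples [(a, b, c)] with [a -> b], [b -> c] and [a -> c]. *)
Definition transitive_triples (V : finType) (G : rel V) : {set V * V * V} :=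
  [set t | [&& G t.1.1 t.1.2, G t.1.2 t.2 & G t.1.1 t.2]].

(** The vertex set and the arc set of the transitive tournament listed by the
triple. *)
Definition triple_subdigraph (V : finType) (t : V * V * V) :
    {set V} * {set V * V} :=
  ([set t.1.1; t.1.2; t.2],
   [set (t.1.1, t.1.2); (t.1.2, t.2); (t.1.1, t.2)]).

Section TransitiveTriples.

Variables (V : finType) (G : rel V).
Hypothesis G_irr : irreflexive G.

Lemma irr_rel_neq a b : G a b -> (a == b) = false.
Proof. by move=> Gab; apply/eqP => ab; rewrite ab G_irr in Gab. Qed.

(** The arc set alone determines the triple. *)
Lemma triple_subdigraph_inj :
  {in transitive_triples G &, injective (@triple_subdigraph V)}.
Proof.
move=> [[a b] c] [[a' b'] c']; rewrite !inE /=.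
move=> /and3P[/irr_rel_neq ab /irr_rel_neq bc /irr_rel_neq ac].
move=> /and3P[/irr_rel_neq ab' /irr_rel_neq bc' /irr_rel_neq ac'] [_ eqA].
have: (a, b) \in [set (a', b'); (b', c'); (a', c')] by rewrite -eqA !inE eqxx.
have: (b, c) \in [set (a', b'); (b', c'); (a', c')]
  by rewrite -eqA !inE eqxx orbT.
have: (a, c) \in [set (a', b'); (b', c'); (a', c')]
  by rewrite -eqA !inE eqxx !orbT.
rewrite !inE !xpair_eqE.
move=> /orP[/orP[]|] /andP[/eqP e1 /eqP e2] /orP[/orP[]|] /andP[/eqP e3 /eqP e4]
  /orP[/orP[]|] /andP[/eqP e5 /eqP e6]; subst;
  by rewrite ?eqxx in ab bc ac ab' bc' ac'.
Qed.

Lemma triple_subdigraph_transitive t : t \in transitive_triples G ->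
  triple_subdigraph t \in transitive_subtournaments 3 G.
Proof.
case: t => [[a b] c]; rewrite !inE /= => /and3P[Gab Gbc Gac].
have [ab bc ac] := And3 (irr_rel_neq Gab) (irr_rel_neq Gbc) (irr_rel_neq Gac).
have ba : (b == a) = false by rewrite eq_sym.
have cb : (c == b) = false by rewrite eq_sym.
have ca : (c == a) = false by rewrite eq_sym.
have card3 : #|[set a; b; c]| = 3%N.
  by rewrite -setUA cardsU1 !inE ab ac /= cards2 bc.
apply/and4P; split.
- by rewrite card3.
- apply/forall_inP => -[u v]; rewrite !inE !xpair_eqE /=.
  by move=> /orP[/orP[]|] /andP[/eqP-> /eqP->]; rewrite !eqxx ?orbT.
- apply/and3P; split.
  + apply/subsetP => -[u v]; rewrite !inE !xpair_eqE /=.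
    by move=> /orP[/orP[]|] /andP[/eqP-> /eqP->]; rewrite !eqxx ?orbT.
  + apply/forallP => u; rewrite !inE !xpair_eqE.
    by apply/negP => /orP[/orP[]|] /andP[/eqP-> ];
       rewrite ?ab ?bc ?ac.
  + apply/forall_inP => u; rewrite 2!in_setU !in_set1 => Hu.
    apply/forall_inP => v; rewrite 2!in_setU !in_set1 => Hv.
    by case/orP: Hu => [/orP[]|] /eqP->; case/orP: Hv => [/orP[]|] /eqP->;
       rewrite !inE !xpair_eqE !eqxx ?ab ?bc ?ac ?ba ?cb ?ca.
- rewrite /is_transitive card3; apply/existsP; exists [tuple a; b; c].
  apply/andP; split; first by apply/eqP/setP => u; rewrite !inE orbA.
  apply/forallP => -[[|[|[|i]]] Hi] //; apply/forallP => -[[|[|[|j]]] Hj] //;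
    by rewrite !(tnth_nth a) /= !inE !eqxx ?orbT.
Qed.

Lemma transitive_subtournament_triple T :
  T \in transitive_subtournaments 3 G ->
  exists2 t, t \in transitive_triples G & T = triple_subdigraph t.
Proof.
case: T => S A; rewrite inE /= => /and4P[/eqP cardS subS /and3P[_ irrA tourA]].
rewrite /is_transitive cardS => /existsP[s /andP[/eqP defS trA]].
have trAP (i j : 'I_3) : (i < j)%N -> (tnth s i, tnth s j) \in A.
  by move=> ij; have /forallP/(_ j)/implyP := forallP trA i; apply.
pose a := tnth s (@Ordinal 3 0 isT); pose b := tnth s (@Ordinal 3 1 isT).
pose c := tnth s (@Ordinal 3 2 isT).
have Aab : (a, b) \in A by apply: trAP.
have Abc : (b, c) \in A by apply: trAP.
have Aac : (a, c) \in A by apply: trAP.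
have AG u v : (u, v) \in A -> [/\ u \in S, v \in S & G u v].
  by move=> Auv; have /and3P := forall_inP subS _ Auv.
have eS : S = [set a; b; c].
  rewrite -defS; apply/setP => u; rewrite !inE.
  apply/tnthP/idP => [[[[|[|[|i]]] Hi] ->]|] //.
  - by rewrite [Ordinal Hi](_ : _ = @Ordinal 3 0 isT) ?eqxx //; apply: val_inj.
  - by rewrite [Ordinal Hi](_ : _ = @Ordinal 3 1 isT) ?eqxx ?orbT //;
      apply: val_inj.
  - by rewrite [Ordinal Hi](_ : _ = @Ordinal 3 2 isT) ?eqxx ?orbT //;
      apply: val_inj.
  - by move=> /orP[/orP[]|] /eqP->; eexists.
have noloop u : (u, u) \in A = false.
  by apply/negbTE; move/forallP: irrA => /(_ u).
have asymA u v : (u, v) \in A -> (v, u) \in A = false.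
  move=> Auv; have [Su Sv Guv] := AG _ _ Auv.
  have := forall_inP (forall_inP tourA _ Su) _ Sv.
  by rewrite (irr_rel_neq Guv) Auv; case: ((v, u) \in A).
exists (a, b, c).
  by rewrite inE /=; apply/and3P; split;
    [case: (AG _ _ Aab) | case: (AG _ _ Abc) | case: (AG _ _ Aac)].
congr (_, _) => //=; apply/setP => -[u v]; apply/idP/idP.
  move=> Auv; have [] := AG _ _ Auv.
  rewrite eS !inE => Su Sv _.
  case/orP: Su Auv => [/orP[]|] /eqP->; case/orP: Sv => [/orP[]|] /eqP-> ;
    by rewrite ?noloop ?(asymA _ _ Aab) ?(asymA _ _ Abc) ?(asymA _ _ Aac) //
      !eqxx ?orbT.
by rewrite !inE => /orP[/orP[]|] /eqP->.
Qed.

Lemma num_transitive_triples :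
  num_transitive_subtournaments 3 G = #|transitive_triples G|.
Proof.
rewrite -(card_in_imset triple_subdigraph_inj).
apply: eq_card => T; apply/idP/imsetP => [|[t]].
  by move/transitive_subtournament_triple => [t Ht ->]; exists t.
by move=> Ht ->; apply: triple_subdigraph_transitive.
Qed.

End TransitiveTriples.

(** * Central binomials and sums of two squares *)

Lemma dvdn_predX p k : (0 < p)%N -> (4 %| p.-1)%N -> (4 %| (p ^ k).-1)%N.
Proof.
move=> p0; rewrite -subn1 -eqn_mod_dvd // => /eqP p1.
by rewrite -subn1 -eqn_mod_dvd ?expn_gt0 ?p0 // -modnXm p1 modnXm exp1n.
Qed.

(** All base-[p] digits of [m = (p ^ r - 1) / 4] are [(p - 1) / 4], so doubling
[m] produces no carry. *)
Lemma double_divn p r k : (0 < p)%N -> (4 %| p.-1)%N ->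
  ((2 * ((p ^ r).-1 %/ 4)) %/ p ^ k = 2 * (((p ^ r).-1 %/ 4) %/ p ^ k))%N.
Proof.
move=> p0 p4.
have pX_gt0 i : (0 < p ^ i)%N by rewrite expn_gt0 p0.
have [kr|rk] := leqP k r; last first.
  have le_rk : (p ^ r <= p ^ k)%N by rewrite leq_pexp2l // ltnW.
  have := leq_trunc_div (p ^ r).-1 4; have := pX_gt0 r.
  set m := ((p ^ r).-1 %/ 4)%N => r0 m_le.
  rewrite (@divn_small (2 * m)) 1?(@divn_small m) //; lia.
have [e He] := dvdnP (dvdn_predX k p0 p4).
have [f Hf] := dvdnP (dvdn_predX (r - k) p0 p4).
have Er : (p ^ r = p ^ k * p ^ (r - k))%N by rewrite -expnD subnKC.
have := pX_gt0 k; have := pX_gt0 (r - k)%N => F0 E0.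
have -> : ((p ^ r).-1 %/ 4 = f * p ^ k + e)%N.
  have -> : ((p ^ r).-1 = (f * p ^ k + e) * 4)%N.
    have Fe : (p ^ (r - k) = f * 4 + 1)%N by lia.
    by rewrite Er {}Fe; lia.
  by rewrite mulnK.
by rewrite mulnDr mulnA !divnMDl // !divn_small; lia.
Qed.

Lemma logn_fact_widen p n k : prime p -> (n <= k)%N ->
  logn p n`! = (\sum_(1 <= i < k.+1) n %/ p ^ i)%N.
Proof.
move=> p_pr nk; rewrite logn_fact // [RHS](@big_cat_nat _ _ _ n.+1) //=.
rewrite (_ : (\sum_(n.+1 <= i < k.+1) n %/ p ^ i = 0)%N) ?addn0 //.
rewrite big_nat big1 // => i /andP[ni _].
by rewrite divn_small // (ltn_trans ni) // ltn_expl // prime_gt1.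
Qed.

(** By Legendre's formula, the absence of carries means that [(2 m)`!] and
[m`! * m`!] have the same [p]-adic valuation. *)
Lemma prime_ndvd_central_bin p r : prime p -> (4 %| p.-1)%N ->
  ~~ (p %| 'C(2 * ((p ^ r).-1 %/ 4), (p ^ r).-1 %/ 4))%N.
Proof.
move=> p_pr p4; set m := ((p ^ r).-1 %/ 4)%N.
have bin0 : (0 < 'C(2 * m, m))%N by rewrite bin_gt0; lia.
suff l0 : logn p 'C(2 * m, m) = 0%N.
  by rewrite -[p in (p %| _)%N]expn1 pfactor_dvdn // l0.
have le_m : (m <= 2 * m)%N by rewrite leq_pmull.
have := congr1 (logn p) (bin_fact le_m).
rewrite (_ : (2 * m - m = m)%N); last lia.
rewrite !lognM ?muln_gt0 ?fact_gt0 //.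
suff -> : (logn p (2 * m)`! = logn p m`! + logn p m`!)%N by lia.
rewrite !(@logn_fact_widen p _ (2 * m)) // -big_split /=.
apply: eq_bigr => k _; rewrite addnn -mul2n.
exact: double_divn (prime_gt0 p_pr) p4.
Qed.

(** If [q = x ^ 2 + y ^ 2 = u ^ 2 + v ^ 2], then [q] divides
[(u y - x v) (u y + x v)], and [p] cannot divide both factors, so that [q]
divides one of them.  As that factor squared is at most [q ^ 2] by Brahmagupta's
identity, it is [0], which gives [x ^ 2 = u ^ 2], or its complementary term
vanishes, which parity forbids. *)
Lemma sum_two_squares_uniq (p r : nat) (x y u v : int) : prime p -> odd p ->
  (0 < r)%N -> (p ^ r)%N%:Z = x ^+ 2 + y ^+ 2 ->
  (p ^ r)%N%:Z = u ^+ 2 + v ^+ 2 ->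
  ~~ (p%:Z %| x)%Z -> ~~ (p%:Z %| u)%Z ->
  (x = 1 %[mod 2])%Z -> (u = 1 %[mod 2])%Z -> x ^+ 2 = u ^+ 2.
Proof.
move=> p_pr p_odd r0; set q := (p ^ r)%N => eq_xy eq_uv px pu x2 u2.
have q0 : (0 < q)%N by rewrite expn_gt0 prime_gt0.
have q_odd : odd q by rewrite oddX p_odd orbT.
(* Changing the sign of [v] reduces the second factor to the first one. *)
have case_dvd w : q%:Z = u ^+ 2 + w ^+ 2 -> (q%:Z %| u * y - x * w)%Z ->
    x ^+ 2 = u ^+ 2.
  move=> eq_uw /dvdzP[d Hd].
  have brahma : q%:Z ^+ 2 = (u * y - x * w) ^+ 2 + (x * u + y * w) ^+ 2.
    by rewrite {1}expr2 {1}eq_xy eq_uw; ring.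
  have [d0|d0] := eqVneq d 0.
    have : q%:Z * (u ^+ 2 - x ^+ 2) = 0.
      have -> : q%:Z * (u ^+ 2 - x ^+ 2) = (u * y - x * w) * (u * y + x * w).
        have Ey : y ^+ 2 = q%:Z - x ^+ 2 by rewrite eq_xy; ring.
        have Ew : w ^+ 2 = q%:Z - u ^+ 2 by rewrite eq_uw; ring.
        transitivity (u ^+ 2 * y ^+ 2 - x ^+ 2 * w ^+ 2); last by ring.
        by rewrite Ey Ew; ring.
      by rewrite Hd d0 !mul0r.
    by move/eqP; rewrite mulf_eq0 subr_eq0 => /orP[|/eqP->//]; lia.
  have xuyw : x * u + y * w = 0.
    apply/eqP; rewrite -sqrf_eq0 eq_le sqr_ge0 andbT.
    have -> : (x * u + y * w) ^+ 2 = q%:Z ^+ 2 * (1 - d ^+ 2).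
      by rewrite [RHS]mulrBr mulr1 {1}brahma Hd; ring.
    rewrite mulr_ge0_le0 ?sqr_ge0 // subr_le0 -gtz0_ge1.
    by rewrite exprn_even_gt0 // d0.
  have [x' Ex] : exists x', x = 2 * x' + 1.
    by exists (x %/ 2)%Z; rewrite {1}(divz_eq x 2) x2 mulrC.
  have [u' Eu] : exists u', u = 2 * u' + 1.
    by exists (u %/ 2)%Z; rewrite {1}(divz_eq u 2) u2 mulrC.
  have [q' Eq] : exists q' : int, q%:Z = 2 * q' + 1.
    exists q./2%:Z.
    by rewrite -{1}(odd_double_half q) q_odd -mul2n PoszD PoszM addrC.
  have [y' Ey] : exists y', y = 2 * y'.
    have : (2 %| y)%Z; last by move=> /dvdzP[y' ->]; exists y'; rewrite mulrC.
    have : (2 %| y ^+ 2)%Z.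
      apply/dvdzP; exists (q' - 2 * x' ^+ 2 - 2 * x').
      by rewrite -[LHS](addKr (x ^+ 2)) -eq_xy Eq Ex; ring.
    by rewrite !dvdzE abszX Euclid_dvdX // andbT.
  (* [x] and [u] are odd and [y] is even, so [x u + y w] is odd. *)
  have : x * u + y * w = 2 * (2 * x' * u' + x' + u' + y' * w) + 1.
    by rewrite Ex Eu Ey; ring.
  by rewrite xuyw; move: (2 * x' * u' + _ + _ + _) => n; clear; lia.
have pq : (p%:Z %| q%:Z)%Z by rewrite dvdzE /= dvdn_exp.
have p_sqr w : (p%:Z %| w ^+ 2)%Z = (p%:Z %| w)%Z.
  by rewrite !dvdzE abszX Euclid_dvdX // andbT.
have py : ~~ (p%:Z %| y)%Z.
  rewrite -p_sqr; apply: contra px => py; rewrite -p_sqr.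
  have -> : x ^+ 2 = q%:Z - y ^+ 2 by rewrite eq_xy addrK.
  exact: rpredB.
have : (q%:Z %| (u * y - x * v) * (u * y + x * v))%Z.
  apply/dvdzP; exists (u ^+ 2 - x ^+ 2).
  have Ey : y ^+ 2 = q%:Z - x ^+ 2 by rewrite eq_xy; ring.
  have Ev : v ^+ 2 = q%:Z - u ^+ 2 by rewrite eq_uv; ring.
  transitivity (u ^+ 2 * y ^+ 2 - x ^+ 2 * v ^+ 2); first by ring.
  by rewrite Ey Ev; ring.
have p_either : ~~ (p%:Z %| u * y - x * v)%Z \/ ~~ (p%:Z %| u * y + x * v)%Z.
  apply/orP; rewrite -negb_and; apply/negP => /andP[p_sub p_add].
  have : (p%:Z %| 2 * u * y)%Z.
    rewrite (_ : 2 * u * y = (u * y - x * v) + (u * y + x * v)); last by ring.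
    by rewrite rpredD.
  rewrite dvdzE !abszM !Euclid_dvdM // -!dvdzE (negbTE pu) (negbTE py) !orbF.
  by rewrite dvdzE /= dvdn_prime2 // => /eqP p2; rewrite p2 in p_odd.
have q_coprime w : ~~ (p%:Z %| w)%Z -> coprimez q w.
  rewrite dvdzE /coprimez /gcdz => pw; rewrite eqz_nat.
  by apply: coprimeXl; rewrite prime_coprime.
case: p_either => /q_coprime /Gauss_dvdzr E; [rewrite E | rewrite mulrC E].
  move=> H; apply: (@case_dvd (- v)); rewrite ?sqrrN //.
  by rewrite mulrN opprK.
exact: case_dvd.
Qed.
(** An even power of an odd [p] is 1 modulo 8, so [r] is odd and
[p ^ r = p] modulo 8. *)
Lemma prime_power_mod8 p r : prime p -> (p ^ r = 5 %[mod 8])%N ->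
  (0 < r)%N /\ (p = 5 %[mod 8])%N.
Proof.
move=> p_pr pr5.
have r0 : (0 < r)%N by rewrite lt0n; apply/negP => /eqP r0; rewrite r0 in pr5.
split=> //.
have p_odd : odd p.
  have : odd (p ^ r).
    by rewrite (divn_eq (p ^ r) 8) pr5 oddD oddM andbF.
  by rewrite oddX eqn0Ngt r0.
have p2 : (p ^ 2 = 1 %[mod 8])%N.
  rewrite -modnXm; have := ltn_pmod p (isT : (0 < 8)%N).
  have : odd (p %% 8) by move: p_odd; rewrite {1}(divn_eq p 8) oddD oddM andbF.
  by case: (p %% 8)%N => [|[|[|[|[|[|[|[|]]]]]]]].
have : (p ^ r = p ^ odd r %[mod 8])%N.
  rewrite -{1}(odd_double_half r) expnD -mul2n expnM -modnMmr -modnXm p2.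
  by rewrite modnXm exp1n modnMmr muln1.
by rewrite pr5; case: (odd r) => //= <-; rewrite expn1.
Qed.

(** * Powers in a finite field *)

Section PowersInFiniteFields.

Variable F : finFieldType.
Local Notation q := #|F|.

Lemma finField_expX (c : F) : c != 0 -> c ^+ q.-1 = 1.
Proof.
move=> c0; apply: (mulfI c0).
by rewrite -exprS prednK ?expf_card ?mulr1 // (cardD1 c).
Qed.

Lemma card_finField_pred_gt0 : (0 < q.-1)%N.
Proof. by rewrite -subn1 subn_gt0 finNzRing_gt1. Qed.

Lemma finField_prim_root : exists g : F, (q.-1).-primitive_root g.
Proof.
have q0 := card_finField_pred_gt0.
have /hasP[g _ g_prim] : has (q.-1).-primitive_root (enum (predC1 (0 : F))).
  apply: has_prim_root => //.
  - apply/allP => c; rewrite mem_enum inE => c0.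
    by apply/unity_rootP/finField_expX.
  - exact: enum_uniq.
  - by rewrite -cardE cardC1.
by exists g.
Qed.

Lemma natr_card_finField : q%:R = 0 :> F.
Proof.
have : \sum_(c : F) c = \sum_(c : F) (c + 1).
  by apply: reindex_inj; apply: addIr.
by rewrite big_split sumr_const /= -{1}[LHS]addr0 => /addrI.
Qed.

Section Divisor.

Variable d : nat.
Hypothesis d_dvd : (d %| q.-1)%N.
Local Notation e := (q.-1 %/ d)%N.

Let q1 : (0 < q.-1)%N.
Proof. exact: card_finField_pred_gt0. Qed.

Let d0 : (0 < d)%N. Proof. exact: dvdn_gt0 d_dvd. Qed.
Let e0 : (0 < e)%N. Proof. by rewrite divn_gt0 // dvdn_leq. Qed.
Let de : (d * e = q.-1)%N. Proof. by rewrite mulnC divnK. Qed.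

Lemma expX_neq0 (u : F) : u ^+ e = 1 -> u != 0.
Proof.
move=> u1; apply/eqP => u0; move/eqP: u1.
by rewrite u0 expr0n eqn0Ngt e0 eq_sym oner_eq0.
Qed.

(** For [d] dividing [q - 1], the nonzero [d]-th powers form the kernel of
[u |-> u ^ ((q - 1) / d)]. *)
Lemma expX_eq1P (u : F) :
  reflect (exists2 c, c != 0 & u = c ^+ d) (u ^+ e == 1).
Proof.
apply: (iffP eqP) => [u1 | [c c0 ->]]; last first.
  by rewrite -exprM de finField_expX.
have [g g_prim] := finField_prim_root.
have [[i /= _] Du] := prim_rootP g_prim (finField_expX (expX_neq0 u1)).
have : (d %| i)%N.
  move/eqP: u1; rewrite Du -exprM -(prim_order_dvd g_prim).
  by rewrite -[X in (X %| _)%N]de dvdn_pmul2r.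
move=> /dvdnP[j Di]; exists (g ^+ j); last by rewrite -exprM -Di.
by rewrite expf_neq0 // (prim_root_eq0 g_prim) -lt0n.
Qed.

Lemma card_expX (u : F) : u ^+ e = 1 -> #|[set c : F | c ^+ d == u]| = d.
Proof.
move=> u1; have u0 := expX_neq0 u1.
have [c0 c0_neq0 Du] := expX_eq1P u (introT eqP u1).
have [g g_prim] := finField_prim_root.
have w_prim := dvdn_prim_root g_prim d_dvd; set w := g ^+ _ in w_prim.
have inj : injective (fun i : 'I_d => c0 * w ^+ i).
  move=> i j /(mulfI c0_neq0) /eqP; rewrite (eq_prim_root_expr w_prim).
  by rewrite !modn_small // => /eqP /val_inj.
rewrite -[RHS]card_ord -cardsT -(card_imset _ inj).
apply: eq_card => c; rewrite !inE; apply/eqP/imsetP => [Dc | [i _ ->]].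
  have : (c / c0) ^+ d = 1 by rewrite expr_div_n Dc -Du divff.
  by move/(prim_rootP w_prim) => [i Di]; exists i; rewrite // -Di mulrC divfK.
by rewrite exprMn exprAC (prim_expr_order w_prim) expr1n mulr1.
Qed.

(** [c |-> c ^ d] is [d]-to-one from the nonzero elements onto the nonzero
[d]-th powers. *)
Lemma sum_expX (R : nzRingType) (f : F -> R) :
  \sum_(c | c != 0) f (c ^+ d) = \sum_(u | u ^+ e == 1) f u *+ d.
Proof.
rewrite (partition_big (fun c => c ^+ d) (fun u => u ^+ e == 1)) /=; last first.
  by move=> c c0; apply/expX_eq1P; exists c.
apply: eq_bigr => u /eqP u1.
rewrite (eq_bigr (fun=> f u)) => [|c /andP[_ /eqP-> //]].
rewrite -[in RHS](card_expX u1) -sumr_const; apply: eq_bigl => c.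
rewrite inE andb_idl // => /eqP Dc.
by apply: contraNneq (expX_neq0 u1) => c0; rewrite -Dc c0 expr0n eqn0Ngt d0.
Qed.

Lemma card_expX_eq1 : #|[set u : F | u ^+ e == 1]| = e.
Proof.
have := sum_expX (fun=> 1 : int); rewrite !sumr_const cardC1.
rewrite -mulrnA => /eqP; rewrite eqr_nat => /eqP h.
apply/eqP; rewrite -(eqn_pmul2l d0) [X in _ == X]de [X in _ == X]h.
rewrite eqn_pmul2l //; apply/eqP.
by apply: eq_card => u; rewrite inE.
Qed.

End Divisor.

Lemma sum_exp_finField (k : nat) : (0 < k)%N ->
  \sum_(c : F) c ^+ k = - ((q.-1 %| k)%N)%:R.
Proof.
move=> k0; have [g g_prim] := finField_prim_root.
have g0 : g != 0.
  by rewrite (prim_root_eq0 g_prim) -lt0n card_finField_pred_gt0.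
rewrite (prim_order_dvd g_prim).
have [g1|g1] := eqVneq (g ^+ k) 1.
  have [j Dk] : exists j, (k = q.-1 * j)%N.
    move/eqP: g1; rewrite -(prim_order_dvd g_prim) => /dvdnP[j ->].
    by exists j; rewrite mulnC.
  rewrite (bigD1 0) //= expr0n eqn0Ngt k0 add0r.
  rewrite (eq_bigr (fun=> 1)) => [|c c0].
    rewrite sumr_const cardC1; apply/eqP; rewrite -addr_eq0 -mulrSr prednK.
      by rewrite natr_card_finField.
    by rewrite (cardD1 0).
  by rewrite Dk exprM finField_expX // expr1n.
rewrite oppr0; apply/eqP.
(* Multiplying by the generator [g] permutes the terms. *)
have : g ^+ k * \sum_(c : F) c ^+ k = \sum_(c : F) c ^+ k.
  rewrite mulr_sumr [RHS](reindex_inj (mulfI g0)).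
  by apply: eq_bigr => c _; rewrite exprMn.
move/eqP; rewrite -subr_eq0 -[X in _ - X]mul1r -mulrBl mulf_eq0 subr_eq0.
by rewrite (negPf g1).
Qed.

End PowersInFiniteFields.

(** * The quadratic character *)

Section QuadraticCharacter.

Variable F : finFieldType.
Hypothesis q_odd : (2 %| #|F|.-1)%N.
Local Notation q := #|F|.
Local Notation n := (q.-1 %/ 2)%N.

(** The quadratic character of a field of odd order, with integer values and
[qchar 0 = 0], defined by Euler's criterion. *)
Definition qchar (x : F) : int :=
  if x == 0 then 0 else if x ^+ n == 1 then 1 else -1.

Lemma qchar0 : qchar 0 = 0.
Proof. by rewrite /qchar eqxx. Qed.

Lemma qchar1 : qchar 1 = 1.
Proof. by rewrite /qchar oner_eq0 expr1n eqxx. Qed.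

Lemma expX_half (x : F) : x != 0 -> x ^+ n = 1 \/ x ^+ n = -1.
Proof.
move=> x0; have : (x ^+ n) ^+ 2 == 1.
  by rewrite -exprM divnK // finField_expX.
by rewrite sqrf_eq1 => /orP[] /eqP->; [left | right].
Qed.

Lemma qcharM (x y : F) : qchar (x * y) = qchar x * qchar y.
Proof.
rewrite /qchar mulf_eq0; have [|x0] := eqVneq x 0; first by rewrite mul0r.
have [|y0] := eqVneq y 0; first by rewrite mulr0.
rewrite /= exprMn; case: (expX_half x0) => ->; case: (expX_half y0) => ->;
  by rewrite ?mulrNN ?mulr1 ?mul1r eqxx; case: (-1 == 1 :> F);
     rewrite ?mulr1 ?mulrNN.
Qed.

Lemma qchar_sqr (x : F) : x != 0 -> qchar x ^+ 2 = 1.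
Proof. by rewrite /qchar => /negPf->; case: ifP. Qed.

Lemma qcharX2 (x : F) : x != 0 -> qchar (x ^+ 2) = 1.
Proof. by move=> x0; rewrite expr2 qcharM -expr2 qchar_sqr. Qed.

Lemma qcharV (x : F) : qchar x^-1 = qchar x.
Proof.
have [->|x0] := eqVneq x 0; first by rewrite invr0.
by rewrite -[LHS]mul1r -(qcharX2 x0) -qcharM expr2 mulfK.
Qed.

(** The value of the character, read in [F]. *)
Lemma qchar_intr (x : F) : (qchar x)%:~R = x ^+ n :> F.
Proof.
have [->|x0] := eqVneq x 0.
  have n0 : (0 < n)%N by rewrite divn_gt0 // dvdn_leq // card_finField_pred_gt0.
  by rewrite qchar0 expr0n eqn0Ngt n0.
rewrite /qchar (negPf x0); case: (expX_half x0) => ->; rewrite ?eqxx //.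
by case: eqP => [->|].
Qed.

(** Every [v] has [1 + qchar v] square roots. *)
Lemma sum_sqr (f : F -> int) :
  \sum_c f (c ^+ 2) = \sum_v (1 + qchar v) * f v.
Proof.
rewrite (bigD1 0) //= [RHS](bigD1 0) //= qchar0 addr0 mul1r expr0n.
congr (_ + _); rewrite (sum_expX q_odd) [RHS](bigID (fun v => v ^+ n == 1)) /=.
rewrite [X in _ + X]big1 ?addr0 => [|v /andP[v0 v1]]; last first.
  by rewrite /qchar (negPf v0) (negPf v1) subrr mul0r.
apply: eq_big => [v|v v1].
  by rewrite andb_idl // => /eqP/(expX_neq0 q_odd).
by rewrite /qchar (negPf (expX_neq0 q_odd (eqP v1))) v1 mulrDl mul1r.
Qed.

Lemma sum_qchar : \sum_x qchar x = 0.
Proof.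
have := sum_sqr (fun=> 1).
under [RHS]eq_bigr do rewrite mulr1.
by rewrite big_split /= -{1}[LHS]addr0 => /addrI.
Qed.

Lemma sum_qchar_shift (d : F) :
  \sum_a qchar a * qchar (a + d) = (d == 0)%:R * q%:R - 1.
Proof.
rewrite (bigD1 0) //= qchar0 mul0r add0r.
have [->|d0] := eqVneq d 0.
  rewrite mul1r (eq_bigr (fun=> 1)) => [|a a0]; last first.
    by rewrite addr0 -expr2 qchar_sqr.
  rewrite sumr_const cardC1; apply/eqP.
  rewrite eq_sym subr_eq -mulrSr prednK //.
  by rewrite (cardD1 0).
rewrite mul0r sub0r.
(* For [a != 0], [a (a + d)] is [a ^ 2] times [1 + d / a]. *)
transitivity (\sum_(a | a != 0) qchar (1 + d * a)).
  rewrite (reindex_inj invr_inj) /=.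
  apply: eq_big => [a|a]; rewrite invr_eq0 // => a0.
  by rewrite -qcharM -[LHS]mul1r -(qcharX2 a0) -qcharM; congr qchar; field.
apply/eqP; rewrite -addr_eq0 addrC; apply/eqP.
rewrite -[RHS]sum_qchar [RHS](reindex_inj (addrI 1)).
rewrite [RHS](reindex_inj (mulfI d0)) /=.
by rewrite [RHS](bigD1 0) //= mulr0 addr0 qchar1.
Qed.

Lemma sum_qcharD (s t : F) :
  \sum_a qchar (a + s) * qchar (a + t) = (s == t)%:R * q%:R - 1.
Proof.
rewrite (reindex_inj (addIr (- s))) /=.
under eq_bigr => a _ do rewrite addrNK -addrA [- s + t]addrC.
by rewrite sum_qchar_shift subr_eq0 eq_sym.
Qed.

Lemma exists_qcharN1 :
  exists2 g : F, g != 0 & qchar g = -1.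
Proof.
have [g g_prim] := finField_prim_root F.
have q0 := card_finField_pred_gt0 F.
have g0 : g != 0 by rewrite (prim_root_eq0 g_prim) -lt0n.
exists g => //; rewrite /qchar (negPf g0) -(prim_order_dvd g_prim) ifN //.
by rewrite gtnNdvd ?ltn_Pdiv // divn_gt0 // dvdn_leq.
Qed.

End QuadraticCharacter.

(** * Jacobsthal sums *)

Section JacobsthalSums.

Variable F : finFieldType.
Local Notation q := #|F|.
Hypothesis q_mod4 : (4 %| q.-1)%N.

Let q_odd : (2 %| q.-1)%N.
Proof. exact: dvdn_trans q_mod4. Qed.

Lemma qcharN1 : qchar (-1 : F) = 1.
Proof.
have [k Dq] := dvdnP q_mod4.
rewrite /qchar oppr_eq0 oner_eq0 Dq.
rewrite (_ : (k * 4 = k * 2 * 2)%N) ?mulnK //; last by lia.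
by rewrite mulnC exprM sqrrN !expr1n eqxx.
Qed.

Lemma oppr1_neq1 : (-1 == 1 :> F) = false.
Proof.
apply/negP; rewrite eq_sym -addr_eq0 => /eqP two0.
have [k Dq] := dvdnP q_odd.
have Dq1 : q = (k * 2).+1 by rewrite -Dq prednK // (cardD1 (0 : F)).
have := natr_card_finField F.
rewrite Dq1 mulrSr mulnC natrM mulr2n two0 mul0r add0r => /eqP.
by rewrite oner_eq0.
Qed.

Lemma qcharN (x : F) : qchar (- x) = qchar x.
Proof. by rewrite -mulN1r qcharM // qcharN1 mul1r. Qed.

(** The Jacobsthal sum of [qchar (t * (t ^ 2 + a))]. *)
Definition jsum (a : F) : int := \sum_t qchar t * qchar (t ^+ 2 + a).

Lemma jsum0 : jsum 0 = 0.
Proof.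
rewrite -[RHS](sum_qchar q_odd) /jsum; apply: eq_bigr => t _; rewrite addr0.
have [->|t0] := eqVneq t 0; first by rewrite qchar0 mul0r.
by rewrite (qcharX2 q_odd t0) mulr1.
Qed.

Lemma jsum_sqrM (c a : F) : c != 0 -> jsum (c ^+ 2 * a) = qchar c * jsum a.
Proof.
move=> c0; rewrite /jsum (reindex_inj (mulfI c0)) /= mulr_sumr.
apply: eq_bigr => t _; rewrite exprMn -mulrDr (qcharM q_odd c t).
by rewrite (qcharM q_odd (c ^+ 2)) (qcharX2 q_odd c0) mul1r mulrA.
Qed.

Lemma jsum_sqr_same_class (a b : F) : a != 0 -> b != 0 -> qchar a = qchar b ->
  jsum a ^+ 2 = jsum b ^+ 2.
Proof.
move=> a0 b0 ab.
have : (a / b) ^+ (q.-1 %/ 2) == 1.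
  have := qchar_sqr a0; rewrite expr2 {2}ab -(qcharV q_odd b) -qcharM //.
  by rewrite /qchar mulf_eq0 invr_eq0 (negPf a0) (negPf b0) /=; case: eqP.
move=> /(expX_eq1P q_odd)[c c0 Dc].
have -> : a = c ^+ 2 * b by rewrite -Dc divfK.
by rewrite jsum_sqrM // exprMn qchar_sqr // mul1r.
Qed.

(** Expanding the square, the sum over [a] of
[qchar (s ^ 2 + a) * qchar (t ^ 2 + a)] is [q [s ^ 2 = t ^ 2] - 1], so that only
the pairs [t = s] and [t = - s] with [s != 0] contribute. *)
Lemma sum_jsum_sqr : \sum_a jsum a ^+ 2 = q%:R * (q.-1%:R *+ 2) :> int.
Proof.
under eq_bigr => a _ do rewrite expr2 /jsum big_distrlr /=.
rewrite exchange_big /=.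
under eq_bigr => t _ do rewrite exchange_big /=.
have inner (s t : F) : \sum_a qchar s * qchar (s ^+ 2 + a) *
    (qchar t * qchar (t ^+ 2 + a)) =
    qchar s * qchar t * ((s ^+ 2 == t ^+ 2)%:R * q%:R - 1).
  rewrite -(sum_qcharD q_odd) mulr_sumr; apply: eq_bigr => a _.
  by rewrite ![_ ^+ 2 + a]addrC; ring.
under eq_bigr => s _ do
  under eq_bigr => t _ do rewrite inner mulrBr mulr1 mulrA.
under eq_bigr => s _ do
  rewrite sumrB -mulr_suml -mulr_sumr sum_qchar // mulr0 subr0.
rewrite -mulr_suml mulrC; congr (_ * _).
rewrite (bigD1 0) //= big1 ?add0r => [|t _]; last by rewrite qchar0 !mul0r.
rewrite -(cardC1 (0 : F)) -sumr_const -sumrMnl; apply: eq_bigr => s s0.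
have sNs : (- s == s) = false.
  by rewrite -[X in _ == X]mul1r -mulN1r (inj_eq (mulIf s0)) oppr1_neq1.
rewrite (bigD1 s) //= (bigD1 (- s)) ?sNs //= big1 ?addr0 => [|t /andP[ts tNs]].
  by rewrite sqrrN !eqxx !mulr1 qcharN -expr2 qchar_sqr.
rewrite eqf_sqr -(eqr_oppLR s) eq_sym (negPf ts) (eq_sym _ t) (negPf tNs).
by rewrite mulr0.
Qed.

(** [jsum a ^ 2] depends only on the square class of [a != 0], and both classes
have the same size. *)
Lemma jsum_sum_two_squares (g : F) : g != 0 -> qchar g = -1 ->
  jsum (-1) ^+ 2 + jsum g ^+ 2 = 4 * q%:R.
Proof.
move=> g0 g1.
have q_pos : q.-1%:R != 0 :> int.
  by rewrite pnatr_eq0 -lt0n card_finField_pred_gt0.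
have split_sqr (a : F) : a != 0 -> jsum a ^+ 2 *+ 2 =
    (jsum (-1) ^+ 2 + jsum g ^+ 2) + qchar a * (jsum (-1) ^+ 2 - jsum g ^+ 2).
  move=> a0; have : qchar a = 1 \/ qchar a = -1.
    by rewrite /qchar (negPf a0); case: ifP; [left | right].
  case=> a1.
    rewrite (@jsum_sqr_same_class a (-1)) ?oppr_eq0 ?oner_eq0 ?qcharN1 //.
    by rewrite a1; ring.
  by rewrite (@jsum_sqr_same_class a g) ?a1 ?g1 //; ring.
have sum0 : \sum_(a : F | a != 0) qchar a = 0.
  by have := sum_qchar q_odd; rewrite (bigD1 0) //= qchar0 add0r.
have := congr1 (fun z : int => z *+ 2) sum_jsum_sqr.
rewrite /= (bigD1 0) //= jsum0 expr0n add0r -sumrMnl.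
rewrite (eq_bigr _ split_sqr) big_split /= -mulr_suml sum0 mul0r addr0.
rewrite sumr_const cardC1 => eq_sum.
by apply: (mulfI q_pos); rewrite [LHS]mulr_natl eq_sum; ring.
Qed.

End JacobsthalSums.

(** * Fourth powers when q is 5 modulo 8 *)

Section QuarticCount.

Variable F : finFieldType.
Local Notation q := #|F|.
Local Notation m := (q.-1 %/ 4)%N.
Hypothesis q_mod8 : (q = 5 %[mod 8])%N.

Lemma card_mod8_odd : exists2 k, (q = 4 * k + 1)%N & odd k.
Proof.
exists (2 * (q %/ 8) + 1)%N; last by rewrite oddD oddM.
by rewrite {1}(divn_eq q 8) q_mod8; lia.
Qed.

Let m_odd : odd m.
Proof. by have [k -> k_odd] := card_mod8_odd; rewrite addn1 mulKn. Qed.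

Let q_mod4 : (4 %| q.-1)%N.
Proof. by have [k -> _] := card_mod8_odd; rewrite addn1 dvdn_mulr. Qed.

Let q_odd : (2 %| q.-1)%N.
Proof. exact: dvdn_trans q_mod4. Qed.

Let qE : q = (4 * m + 1)%N.
Proof. by have [k -> _] := card_mod8_odd; rewrite addn1 mulKn ?addn1. Qed.

Let nE : (q.-1 %/ 2 = m * 2)%N.
Proof.
have [k -> _] := card_mod8_odd; rewrite addn1 /= mulKn //.
by rewrite (_ : 4 * k = k * 2 * 2)%N ?mulnK //; lia.
Qed.

Lemma signr_m : (-1) ^+ m = -1 :> F.
Proof. by rewrite -signr_odd m_odd expr1. Qed.

(** The nonzero fourth powers [u] such that [1 - u] is also a nonzero fourth
power, the nonzero fourth powers being encoded as the roots of [u ^ m = 1] with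
[m = (q - 1) / 4]; they correspond to the ways of writing 1 as the sum of an
ordered pair of such powers. *)
Definition quartic_pairs : {set F} :=
  [set u | (u ^+ m == 1) && ((1 - u) ^+ m == 1)].

(** For [u ^ m = 1], [1 - u^-1 = - (1 - u) / u] has the [m]-th power opposite to
that of [1 - u]. *)
Lemma card_quartic_pairsN :
  #|[set u : F | (u ^+ m == 1) && ((1 - u) ^+ m == -1)]| = #|quartic_pairs|.
Proof.
rewrite -!sum1dep_card (reindex_inj invr_inj) /=; apply: eq_bigl => u.
rewrite exprVn invr_eq1; case: eqP => //= u1; rewrite ?inE ?andbF //.
have u0 := expX_neq0 q_mod4 u1.
have -> : 1 - u^-1 = - 1 * (1 - u) * u^-1 by field.
by rewrite !exprMn exprVn u1 invr1 mulr1 signr_m mulN1r eqr_opp.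
Qed.

Lemma sum_qchar_quartic :
  \sum_(u : F | u ^+ m == 1) qchar (1 - u) =
    4 * #|quartic_pairs|%:R + 1 - m%:R.
Proof.
(* [v ^ (2 m) = 1] exactly when [v ^ m] is 1 or -1, and not both. *)
have qcharE1 (v : F) : qchar v =
    (v == 0)%:R + (v ^+ m == 1)%:R *+ 2 + (v ^+ m == -1)%:R *+ 2 - 1.
  have m0 : (0 < m)%N by rewrite lt0n; apply: contraTneq m_odd => ->.
  rewrite /qchar; have [->|v0] := eqVneq v 0.
    by rewrite expr0n eqn0Ngt m0 !(eq_sym 0) oppr_eq0 oner_eq0.
  rewrite nE exprM sqrf_eq1.
  have [->|_] := eqVneq (v ^+ m) 1; last by case: eqP.
  by rewrite (eq_sym 1) oppr1_neq1.
rewrite (eq_bigr _ (fun u _ => qcharE1 (1 - u))) !big_split /=.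
have sum_ind (P Q : pred F) :
    \sum_(u | P u) (Q u)%:R = #|[set u | P u && Q u]|%:R :> int.
  rewrite -sum1dep_card natr_sum big_mkcondr; apply: eq_bigr => u _.
  by case: ifP.
rewrite !sum_ind card_quartic_pairsN sumrN sumr_const -/quartic_pairs.
have -> : #|[set u : F | u ^+ m == 1 & 1 - u == 0]| = 1%N.
  rewrite -[RHS](cards1 (1 : F)); apply: eq_card => u; rewrite !inE.
  by rewrite subr_eq0 (eq_sym 1); case: (eqVneq u 1) => [->|_];
     rewrite ?expr1n ?eqxx ?andbF.
have -> : #|[pred u : F | u ^+ m == 1]| = m.
  by rewrite -[RHS](card_expX_eq1 q_mod4); apply: eq_card => u; rewrite !inE.
ring.
Qed.

(** The substitution [v = c ^ 2] splits the sum into that of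
[qchar (1 - v ^ 2)], which is -1, and a Jacobsthal sum. *)
Lemma sum_qchar_1sub_expX4 :
  \sum_(c : F) qchar (1 - c ^+ 4) = -1 + jsum (-1 : F).
Proof.
have sum_N : \sum_(v : F) qchar (1 - v ^+ 2) = -1.
  transitivity (\sum_(v : F) qchar (v + 1) * qchar (v + (-1))).
    apply: eq_bigr => v _; rewrite -(qcharM q_odd) -(qcharN q_mod4).
    by congr qchar; ring.
  by rewrite (sum_qcharD q_odd) eq_sym oppr1_neq1 // mul0r sub0r.
transitivity (\sum_(c : F) qchar (1 - (c ^+ 2) ^+ 2)).
  by apply: eq_bigr => c _; rewrite -exprM.
rewrite (sum_sqr q_odd (fun v => qchar (1 - v ^+ 2))).
under eq_bigr => v _ do rewrite mulrDl mul1r.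
rewrite big_split /= sum_N; congr (_ + _); apply: eq_bigr => v _.
by rewrite -(qcharN q_mod4 (1 - _)) opprB.
Qed.

Lemma jsumN1_quartic : jsum (-1 : F) = 16 * #|quartic_pairs|%:R - q%:R + 7.
Proof.
have sum4_fibre : \sum_(c : F) qchar (1 - c ^+ 4) =
    1 + (4 * #|quartic_pairs|%:R + 1 - m%:R) *+ 4.
  rewrite (bigD1 0) //= expr0n subr0 qchar1; congr (_ + _).
  rewrite (sum_expX q_mod4 (fun u => qchar (1 - u))).
  by rewrite sumrMnl sum_qchar_quartic.
have := etrans (esym sum_qchar_1sub_expX4) sum4_fibre.
have -> : q%:R = 4 * m%:R + 1 :> int by rewrite {1}qE natrD natrM.
move=> /(canRL (addKr _)) ->; ring.
Qed.

(** In [F] the character is the [2 m]-th power.  Expanding [(1 - c ^ 4) ^ (2 m)]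
and summing over [c], only the terms of exponent [4 m] and [8 m] in [c]
survive. *)
Lemma jsumN1_bin : (jsum (-1 : F))%:~R = 'C(2 * m, m)%:R :> F.
Proof.
have m0 : (0 < m)%N by rewrite lt0n; apply: contraTneq m_odd => ->.
have sum4_jsum : jsum (-1 : F) = \sum_(c : F) qchar (1 - c ^+ 4) + 1.
  by rewrite sum_qchar_1sub_expX4 addrC addNKr.
rewrite sum4_jsum rmorphD rmorph_sum /=.
under eq_bigr => c _ do rewrite (qchar_intr q_odd) nE mulnC exprBn.
rewrite exchange_big /=.
have q1E : q.-1 = (4 * m)%N by rewrite {1}qE addn1.
have inner (j : nat) :
  \sum_(c : F) ((-1) ^+ j * 1 ^+ (2 * m - j) * (c ^+ 4) ^+ j) *+ 'C(2 * m, j) =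
  ((-1) ^+ j * - ((0 < j)%N && (m %| j)%N)%:R) *+ 'C(2 * m, j).
  rewrite sumrMnl; congr (_ *+ _); rewrite expr1n mulr1 -mulr_sumr.
  congr (_ * _).
  under eq_bigr => c _ do rewrite -exprM.
  have [j0|j0] := posnP j.
    by rewrite j0 muln0 sumr_const natr_card_finField /= oppr0.
  rewrite sum_exp_finField ?muln_gt0 // (_ : (q.-1 %| 4 * j) = (m %| j))%N //.
  by rewrite {1}q1E dvdn_pmul2l.
under eq_bigr => j _ do rewrite inner.
have m_lt : (m < (2 * m).+1)%N by rewrite ltnS leq_pmull.
rewrite (bigD1 ord_max) //= (bigD1 (Ordinal m_lt)) /=; last first.
  by rewrite -val_eqE /= -[X in X != _]mul1n eqn_pmul2r.
rewrite big1 => [|j /andP[j_max j_m]]; last first.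
  have [j0|j0] := posnP j; first by rewrite oppr0 mulr0 mul0rn.
  case: dvdnP => [[k Dj]|_]; last by rewrite oppr0 mulr0 mul0rn.
  have := ltn_ord j; move: j_max j_m; rewrite -!val_eqE /= ltnS Dj => k2 k1.
  rewrite leq_pmul2r // => k_le.
  by move: j0; rewrite Dj; case: k k_le k1 k2 {Dj} => [|[|[|]]] //=;
    rewrite ?mul0n ?mul1n ?eqxx.
rewrite binn dvdnn dvdn_mull // m0 muln_gt0 m0 exprM sqrrN expr1n expr1n.
rewrite signr_m.
by rewrite /= mulr1n addr0 mulrNN !mul1r addrAC addNr add0r.
Qed.

Lemma G4E (a b : F) : G4 a b = ((b - a) ^+ m == 1).
Proof.
apply/existsP/(expX_eq1P q_mod4) => [[c /andP[c0 /eqP Dc]] | [c c0 Dc]];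
  by exists c; rewrite ?c0 ?Dc /=.
Qed.

Lemma G4_irr : irreflexive (@G4 F).
Proof.
move=> a; apply/negbTE/negP; rewrite G4E => /eqP/(expX_neq0 q_mod4).
by rewrite subrr eqxx.
Qed.

(** The triple [(a, b, c)] corresponds to [a], [h = c - a] and
[u = (b - a) / (c - a)]. *)
Lemma card_transitive_triples_G4 :
  #|transitive_triples (@G4 F)| = (q * (m * #|quartic_pairs|))%N.
Proof.
rewrite -[X in _ = (X * _)%N]cardsT.
rewrite -[X in (X * #|quartic_pairs|)%N](card_expX_eq1 q_mod4).
rewrite -!cardsX.
pose f (t : F * (F * F)) := (t.1, t.1 + t.2.1 * t.2.2, t.1 + t.2.1).
rewrite -(@card_in_imset _ _ f).
  apply: eq_card => -[[a b] c]; rewrite inE /= !G4E.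
  apply/idP/imsetP => [/and3P[/eqP ab /eqP bc /eqP ac]|].
    have h0 := expX_neq0 q_mod4 ac.
    exists (a, (c - a, (b - a) / (c - a))); last first.
      by rewrite /f /= [_ * (_ / _)]mulrC divfK // !(addrC a) !subrK.
    rewrite !inE /= ac eqxx expr_div_n ab ac divr1 eqxx /=.
    have -> : 1 - (b - a) / (c - a) = (c - b) / (c - a) by field.
    by rewrite expr_div_n bc ac divr1.
  case=> -[a' [h u]]; rewrite !inE /= => /andP[/eqP h1 /andP[/eqP u1 /eqP u2]].
  case=> -> -> ->; apply/and3P; split; apply/eqP.
  - by rewrite addrC addKr exprMn h1 u1 mulr1.
  - have -> : a' + h - (a' + h * u) = h * (1 - u) by ring.
    by rewrite exprMn h1 u2 mulr1.
  - by rewrite addrC addKr.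
move=> [a [h u]] [a' [h' u']]; rewrite !inE /=.
move=> /andP[/eqP/(expX_neq0 q_mod4) h0 _] _ [<-] /[swap] /addrI <- /addrI.
by move/(mulfI h0) => <-.
Qed.

End QuarticCount.

(** * The number of transitive triangles *)

Theorem corollary2p8 (p r q : nat) (F : finFieldType) (x y : int)
    (p_prime : prime p) (q_pow : q = (p ^ r)%N) (q_mod8 : (q = 5 %[mod 8])%N)
    (cardF : #|F| = q)
    (q_sum : q%:Z = x ^+ 2 + y ^+ 2)
    (x_mod4 : (x = 1 %[mod 4])%Z)
    (p_ndvd_x : ~~ (p%:Z %| x)%Z) :
  (num_transitive_subtournaments 3 (@G4 F))%:R =
    q%:R * (q%:R - 1) * (q%:R + 2 * x%:~R - 7) / 2 ^+ 6 :> rat.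
Proof.
have F_mod8 : (#|F| = 5 %[mod 8])%N by rewrite cardF.
have [k Dq k_odd] := card_mod8_odd F_mod8.
have q_mod4 : (4 %| #|F|.-1)%N by rewrite Dq addn1 dvdn_mulr.
have mE : (#|F|.-1 %/ 4 = k)%N by rewrite Dq addn1 mulKn.
rewrite (num_transitive_triples (G4_irr F_mod8)).
rewrite (card_transitive_triples_G4 F_mod8) mE.
set N := #|quartic_pairs F|.
(* [x0] is [jsum (-1) / 2], written so as to avoid the division. *)
pose x0 : int := 8 * N%:R - 2 * k%:R + 3.
have jE : jsum (-1 : F) = 2 * x0.
  by rewrite (jsumN1_quartic F_mod8) Dq natrD natrM /x0 -/N; ring.
suff x_eq : x = x0.
  by rewrite x_eq /x0 -cardF Dq; field.
have q_odd : (2 %| #|F|.-1)%N by apply: dvdn_trans q_mod4.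
rewrite q_pow in q_mod8; have [r0 p_mod8] := prime_power_mod8 p_prime q_mod8.
have p_odd : odd p by rewrite (divn_eq p 8) p_mod8 oddD oddM andbF.
have p_mod4 : (4 %| p.-1)%N.
  rewrite (divn_eq p 8) p_mod8 addnS /= dvdn_add //.
  by rewrite dvdn_mull.
have p_ndvd_x0 : ~~ (p%:Z %| x0)%Z.
  apply/negP => /dvdzP[z Dz].
  have pF : p \in [pchar F].
    exact: card_finPcharP (etrans cardF q_pow) p_prime.
  have := jsumN1_bin F_mod8; rewrite jE Dz !rmorphM /=.
  rewrite -[(p%:Z)%:~R]/(p%:R) (pcharf0 pF) !mulr0 => /esym/eqP.
  rewrite -(dvdn_pcharf pF) cardF q_pow.
  by apply/negP/prime_ndvd_central_bin.
have [g g0 g1] := exists_qcharN1 q_odd.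
have := jsum_sum_two_squares q_mod4 g0 g1; rewrite jE => two_sq.
have [y0 Dy0] : exists y0, jsum g = 2 * y0.
  suff : (2 %| jsum g)%Z by move=> /dvdzP[y0 ->]; exists y0; rewrite mulrC.
  have : (2 %| jsum g ^+ 2)%Z.
    apply/dvdzP; exists (2 * #|F|%:R - 2 * x0 ^+ 2).
    by rewrite -[LHS](addKr ((2 * x0) ^+ 2)) two_sq; ring.
  by rewrite !dvdzE abszX Euclid_dvdX // andbT.
have q_sum0 : (p ^ r)%N%:Z = x0 ^+ 2 + y0 ^+ 2.
  have four0 : 4 != 0 :> int by [].
  apply: (mulfI four0); rewrite -q_pow -cardF -[Posz #|F|]natz -two_sq Dy0.
  by ring.
(* As [k] is odd, [x0] is congruent to 1 modulo 4. *)
have [j Dk] : exists j : nat, k = (2 * j + 1)%N.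
  by exists k./2; rewrite -{1}(odd_double_half k) k_odd -mul2n addnC.
have x_odd : (x = 1 %[mod 2])%Z.
  by rewrite (divz_eq x 4) x_mod4; clear; lia.
have x0E : x0 = 2 * (4 * N%:Z - 2 * j%:Z) + 1.
  by rewrite /x0 Dk natrD natrM !natz; ring.
have x0_odd : (x0 = 1 %[mod 2])%Z by rewrite x0E; clear; lia.
rewrite q_pow in q_sum.
have := sum_two_squares_uniq p_prime p_odd r0 q_sum q_sum0 p_ndvd_x p_ndvd_x0
  x_odd x0_odd.
move/eqP; rewrite eqf_sqr => /orP[/eqP // | /eqP x_opp].
by move: x_mod4; rewrite x_opp x0E; clear; lia.
Qed.
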